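(* Suppose that $n \in \mathbb{N}$, $s \in (0,\frac{n}{2})$, $\alpha \in (0,n)$, and $\beta > 2s$. Given any $N \in \mathbb{N}$, let $\mathfrak{y}_1, \ldots, \mathfrak{y}_N$ be distinct points in $\mathbb{R}^n$. If $f$ and $V$ are functions such that \[f = \Phi_{n,s} \ast (Vf) \quad \text{in } \mathbb{R}^n \setminus \{\mathfrak{y}_1, \ldots, \mathfrak{y}_N\}\] and \[|f(y)| \le C\left(1 + \sum_{i=1}^N \frac{1}{|y-\mathfrak{y}_i|^{\alpha}}\right),\quad |V(y)| \le \frac{C}{\langle y \rangle^{\beta}} \quad \text{for } y \in \mathbb{R}^n \setminus \{\mathfrak{y}_1, \ldots, \mathfrak{y}_N\}\] for some $C > 0$, then $f \in L^{\infty}(\mathbb{R}^n)$.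
   Context: $\Phi_{n,s}$ is the Riesz potential $\Phi_{n,s}(x) = \frac{\gamma_{n,s}}{|x|^{n-2s}}$ for $x \in \mathbb{R}^n\setminus\{0\}$, with $\gamma_{n,s} = \frac{\Gamma(\frac{n-2s}{2})}{\pi^{n/2}2^{2s}\Gamma(s)}$; $\ast$ is convolution on $\mathbb{R}^n$; $\langle y\rangle = \sqrt{1+|y|^2}$. *)

(* Defs.v *)
From HB Require Import structures.
From mathcomp Require Import all_boot all_order all_algebra.
From mathcomp Require Import all_classical all_reals all_analysis.

Set Implicit Arguments.
Unset Strict Implicit.
Unset Printing Implicit Defensive.

Import Order.TTheory GRing.Theory Num.Theory.
Import numFieldNormedType.Exports.

Local Open Scope classical_set_scope.
Local Open Scope ring_scope.

(* R^n is the type n.-tuple R, which the library equips with the product Borel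
   sigma-algebra. Lebesgue measure on it is not in the library: it is built by
   recursion on n as a product of one-dimensional Lebesgue measures, and then
   completed, so that "measurable" means Lebesgue measurable. *)

Section lebesgue_cons.
Context {R : realType} {n : nat}.

Definition tuple_cons (p : measurableTypeR R * n.-tuple R) : n.+1.-tuple R :=
  [tuple of p.1 :: p.2].

Definition tuple_uncons (t : n.+1.-tuple R) : measurableTypeR R * n.-tuple R :=
  (thead t, [tuple of behead t]).

Lemma tuple_consK : cancel tuple_cons tuple_uncons.
Proof. by move=> [x t]; congr pair; apply/val_inj. Qed.

Lemma measurable_tuple_cons : measurable_fun [set: measurableTypeR R * n.-tuple R] tuple_cons.
Proof.
exact: (@measurable_cons _ _ _ R fst n snd measurable_fst measurable_snd).
Qed.

Lemma measurable_tuple_uncons : measurable_fun [set: n.+1.-tuple R] tuple_uncons.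
Proof.
apply/measurable_fun_pair => /=; last exact: measurable_behead.
exact: measurable_tnth.
Qed.

Variable m : {sigma_finite_measure set (n.-tuple R) -> \bar R}.

Definition lebesgue_cons : set (n.+1.-tuple R) -> \bar R :=
  pushforward (@lebesgue_measure R \x m)%E tuple_cons.

Let preim_meas (A : set (n.+1.-tuple R)) :
  measurable A -> measurable (tuple_cons @^-1` A).
Proof. by move=> mA; rewrite -[X in measurable X]setTI; exact: measurable_tuple_cons. Qed.

Let lebesgue_cons0 : lebesgue_cons set0 = 0%E.
Proof. by rewrite /lebesgue_cons /pushforward preimage_set0 measure0. Qed.

Let lebesgue_cons_ge0 A : (0 <= lebesgue_cons A)%E.
Proof. by rewrite /lebesgue_cons /pushforward; exact: measure_ge0. Qed.

Let lebesgue_cons_sigma_additive : semi_sigma_additive lebesgue_cons.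
Proof.
move=> F mF tF mUF; rewrite /lebesgue_cons /pushforward preimage_bigcup.
apply: measure_semi_sigma_additive.
- by move=> k; exact: preim_meas.
- apply/trivIsetP => /= i j _ _ ij; rewrite -preimage_setI.
  by move/trivIsetP : tF => /(_ _ _ _ _ ij) ->//; rewrite preimage_set0.
- by rewrite -preimage_bigcup; exact: preim_meas.
Qed.

HB.instance Definition _ := isMeasure.Build _ _ _ lebesgue_cons
  lebesgue_cons0 lebesgue_cons_ge0 lebesgue_cons_sigma_additive.

Let lebesgue_cons_sigma_finite : sigma_finite setT lebesgue_cons.
Proof.
have /sigma_finiteP[F [TF ndF Foo]] := sigma_finiteT (@lebesgue_measure R).
have /sigma_finiteP[G [TG ndG Goo]] := sigma_finiteT m.
exists (fun k => tuple_uncons @^-1` (F k `*` G k)).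
  rewrite -preimage_bigcup (_ : \bigcup_k (F k `*` G k) = setT) ?preimage_setT//.
  apply/seteqP; split => // -[x t] _.
  have [i _ Fix] : (\bigcup_i F i) x by rewrite -TF.
  have [j _ Gjt] : (\bigcup_i G i) t by rewrite -TG.
  exists (maxn i j) => //; split => /=.
  - by move: x Fix; exact/subsetPset/ndF/leq_maxl.
  - by move: t Gjt; exact/subsetPset/ndG/leq_maxr.
move=> k; have [mF Fk] := Foo k; have [mG Gk] := Goo k; split.
  rewrite -[X in measurable X]setTI; apply: measurable_tuple_uncons => //.
  exact: measurableX.
rewrite /lebesgue_cons /pushforward -comp_preimage.
rewrite (_ : tuple_uncons \o tuple_cons = id); last first.
  by apply/funext => p; exact: tuple_consK.
by rewrite preimage_id product_measure1E// lte_mul_pinfty// ge0_fin_numE.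
Qed.

HB.instance Definition _ := Measure_isSigmaFinite.Build _ _ _ lebesgue_cons
  lebesgue_cons_sigma_finite.

End lebesgue_cons.

Section euclidean_space.
Context {R : realType}.

Fixpoint borel_lebesgue_measure (n : nat) :
    {sigma_finite_measure set (n.-tuple R) -> \bar R} :=
  match n with
  | 0 => \d_([tuple] : 0.-tuple R)
  | k.+1 => lebesgue_cons (borel_lebesgue_measure k)
  end.

Definition lebesgueRn (n : nat) : measurableType _ :=
  caratheodory_type (borel_lebesgue_measure n)^*%mu.

Definition lebesgue_measureRn (n : nat) : set (lebesgueRn n) -> \bar R :=
  @completed_measure_extension _ _ _ (borel_lebesgue_measure n).
Arguments lebesgue_measureRn : clear implicits.

HB.instance Definition _ (n : nat) := Measure.on (lebesgue_measureRn n).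

Definition tuple_sub (n : nat) (x y : n.-tuple R) : n.-tuple R :=
  [tuple tnth x i - tnth y i | i < n].

Definition enorm (n : nat) (x : n.-tuple R) : R :=
  Num.sqrt (\sum_(i < n) tnth x i ^+ 2).

Definition japanese_bracket (n : nat) (x : n.-tuple R) : R :=
  Num.sqrt (1 + enorm x ^+ 2).

Definition convolution (n : nat) (g h : n.-tuple R -> R) (x : n.-tuple R) :
    \bar R :=
  (\int[lebesgue_measureRn n]_y (g (tuple_sub x y) * h y)%:E)%E.

Definition Gamma (a : R) : R :=
  \int[lebesgue_measure]_(t in `]0, +oo[) (t `^ (a - 1) * expR (- t)).

Definition riesz_const (n : nat) (s : R) : R :=
  Gamma ((n%:R - 2 * s) / 2) / (pi `^ (n%:R / 2) * 2 `^ (2 * s) * Gamma s).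

(* The value at the origin, where the potential is undefined, is irrelevant:
   it only affects integrands on a null set. *)
Definition riesz_potential (n : nat) (s : R) (x : n.-tuple R) : R :=
  riesz_const n s / enorm x `^ (n%:R - 2 * s).

End euclidean_space.

Arguments lebesgueRn R n : clear implicits.
Arguments lebesgue_measureRn {R} n.

(* Main.v *)
Require Import Defs.
From HB Require Import structures.
From mathcomp Require Import all_boot all_order all_algebra.
From mathcomp Require Import all_classical all_reals all_analysis.
From mathcomp Require Import measurable_realfun ess_sup_inf ring lra.

Import Order.TTheory GRing.Theory Num.Theory.
Import numFieldNormedType.Exports.

Local Open Scope classical_set_scope.
Local Open Scope ring_scope.

Set Implicit Arguments.
Unset Strict Implicit.
Unset Printing Implicit Defensive.

(** Write [a = n - 2s], so that the potential is a multiple of [|x|^-a], and let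
    [w y = 1 + sum_i |y - p_i|^-alpha], so that the hypothesis on [f] reads
    [|f| <= C w].  Split the integral in [f = Phi * (V f)] at small balls of
    radius [r] around the points [p_i].

    Off the balls [f] is bounded, and [|x - y|^-a <y>^-beta] has an integral
    bounded uniformly in [x] ([riesz_bracket_bound]): this is where
    [beta > 2s] enters.  Inside the balls, the operator [T] with kernel
    [|x - y|^-a] satisfies [T 1 <= e] and [T w <= e w], with [e] as small as
    desired once [r] is small ([riesz_weight_small]).  Hence a bound
    [|f| <= P + D w] off the points improves itself to
    [|f| <= A + P/2 + (D/2) w] with [A] independent of [P] and [D]
    ([riesz_convolution_improve]).  When [A >= 0], taking [P = 2A]
    preserves [P] and halves [D]; iterating from [D = C] gives [|f| <= 2A] off
    the points, which form a null set.

    The estimate [T w <= e w] rests on a pointwise inequality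
    ([three_point_power]): among [|x - y|] and [|y - p_j|], the larger one is at
    least [|x - p_j| / 2], so [|x - y|^-a |y - p_j|^-alpha] is at most
    [(|x - p_j| / 2)^-m (|x - y|^-M + |y - p_j|^-M)], where [m] and [M] are the
    minimum and the maximum of [a] and [alpha].  As [m <= alpha], the first
    factor is controlled by [w x]; as [M < n], the second one has a small
    integral over a small ball.

    All the [n]-dimensional integrals reduce to the line: [|z| >= |z_i|] for
    each coordinate, so [|z|^-M <= prod_i |z_i|^-(M/n)], with [M/n < 1] locally
    integrable, and Tonelli's theorem bounds the integral of such a product
    ([integral_bound_tensor]).  On the line, the integrals of powers are bounded
    by a dyadic decomposition ([dyadic_integral_le]), which treats the
    singularity and the tail alike and needs neither a primitive nor a change
    of variables. *)

(** * Dyadic decomposition on the line *)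

(** Where [h t] is nonzero it is at most the sum over [k] of [kap k] times the
    indicator of the interval of radius [rho k], and these terms have integrals
    bounded by a geometric series.  For powers of [|t - q|] the intervals are
    those of radius [r 2^-k] near [q], or [2^k] at infinity. *)
Lemma dyadic_integral_le (R : realType) (h : R -> R) (q z c : R)
    (rho kap : nat -> R) :
  measurable_fun setT h -> (forall t, 0 <= h t) ->
  0 <= z < 1 ->
  (forall k, 0 <= rho k) -> (forall k, 0 <= kap k) ->
  (forall k, 2 * rho k * kap k <= c * z ^+ k) ->
  (forall t, h t = 0 \/ exists k, `|t - q| <= rho k /\ h t <= kap k) ->
  (\int[lebesgue_measure]_t (h t)%:E <= (c / (1 - z))%:E)%E.
Proof.
move=> mh h0 /andP[z0 z1] rho0 kap0 rk hcov.
pose I k : set R := `[q - rho k, q + rho k]%classic.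
pose g k t : \bar R := ((kap k)%:E * (\1_(I k) t)%:E)%E.
have mI k : measurable (I k) by exact: measurable_itv.
have mg k : measurable_fun setT (g k).
  apply: measurable_funeM; apply/measurable_EFinP; exact: measurable_indic.
have g0 k t : (0 <= g k t)%E.
  by rewrite /g mule_ge0// lee_fin.
have hg t : ((h t)%:E <= \sum_(0 <= k <oo) g k t)%E.
  case: (hcov t) => [->|[k [tk hk]]].
    by apply: nneseries_ge0 => *; exact: g0.
  apply: (@le_trans _ _ (g k t)).
    rewrite /g indicE mem_set ?mule1 ?lee_fin//.
    by rewrite /I /= in_itv/= -ler_distl.
  rewrite (@nneseriesD1 _ _ k xpredT)//.
  by apply: leeDl; apply: nneseries_ge0 => *; exact: g0.
have gint k : (\int[lebesgue_measure]_t g k t <= (c * z ^+ k)%:E)%E.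
  have mk : measurable_fun setT (EFin \o \1_(I k) : R -> \bar R).
    by apply/measurable_EFinP; exact: measurable_indic.
  rewrite /g ge0_integralZl ?lee_fin//.
  have lI : lebesgue_measure (I k) = (2 * rho k)%:E.
    rewrite /I lebesgue_measure_itv/= lte_fin; case: ifPn => [_|].
      by rewrite -EFinB; congr EFin; ring.
    rewrite -leNgt => H; suff -> : rho k = 0 by rewrite mulr0.
    by have := rho0 k; lra.
  rewrite integral_indic ?setIT; [|exact: measurableT|exact: mI].
  by rewrite [X in (_ * X)%E]lI -EFinM lee_fin mulrC.
have mser : measurable_fun setT (fun t : R => (\sum_(0 <= k <oo) g k t)%E).
  by apply: (@ge0_emeasurable_sum _ _ _ _ g xpredT).
apply: (@le_trans _ _ (\int[lebesgue_measure]_t (\sum_(0 <= k <oo) g k t))%E).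
  apply: ge0_le_integral; [exact: measurableT| | |exact: mser|by move=> t _].
  - by move=> t _; rewrite lee_fin.
  - exact/measurable_EFinP.
rewrite integral_nneseries//.
apply: (@le_trans _ _ (\sum_(0 <= k <oo) (c * z ^+ k)%:E)%E).
  by apply: lee_nneseries => // k _ _; apply: integral_ge0.
have z1' : `|z| < 1 by rewrite ger0_norm.
have gl : limn (series (geometric c z)) = c / (1 - z).
  exact: (cvg_lim (@Rhausdorff R) (@cvg_geometric_series R c z z1')).
rewrite -gl -EFin_lim; last exact: is_cvg_geometric_series.
rewrite (_ : EFin \o _ = eseries (fun k => (c * z ^+ k)%:E))//.
by apply/funext => k; rewrite /= /series/= /eseries/= -sumEFin.
Qed.

Lemma dyadic_scale (R : realType) (u : R) : 1 <= u ->
  exists k, 2 ^+ k <= u < 2 ^+ k.+1.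
Proof.
move=> u1; have ex : exists k, u < 2 ^+ k.+1.
  exists (Num.bound u).
  apply: (lt_trans (archi_boundP _)); first by lra.
  rewrite -natrX ltr_nat; apply: (leq_trans (ltn_expl _ (ltnSn 1))).
  by rewrite leq_exp2l.
exists (ex_minn ex); case: ex_minnP => m um mmin; rewrite um andbT.
case: m um mmin => [|m] um mmin; first by rewrite expr0.
by rewrite leNgt; apply/negP => /mmin; rewrite ltnn.
Qed.

(** * Powers with negative exponents *)

Lemma powRN_le (R : realType) (a x y : R) : 0 <= a -> 0 < x -> x <= y ->
  y `^ (- a) <= x `^ (- a).
Proof.
move=> a0 x0 xy; have y0 := lt_le_trans x0 xy.
rewrite !powRN lef_pV2 ?posrE ?powR_gt0//.
by apply: ge0_ler_powR; rewrite ?nnegrE// ltW.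
Qed.

Lemma powRN_le1 (R : realType) (a x : R) : 0 <= a -> 1 <= x -> x `^ (- a) <= 1.
Proof. by move=> a0 x1; have := powRN_le a0 ltr01 x1; rewrite powR1. Qed.

(** * Bounds on integrals of nonnegative functions *)

Section integral_bound.
Context d (T : measurableType d) (R : realType) (mu : {measure set T -> \bar R}).

(** Measurability and nonnegativity are bundled with the bound so that bounds
    can be added, scaled and compared without integrability side conditions. *)
Definition integral_bound (h : T -> R) (B : R) : Prop :=
  [/\ measurable_fun setT h, (forall t, 0 <= h t) &
      (\int[mu]_t (h t)%:E <= B%:E)%E].

Lemma integral_bound_le (h g : T -> R) B : integral_bound g B ->
  measurable_fun setT h -> (forall t, 0 <= h t <= g t) -> integral_bound h B.
Proof.
move=> [mg g0 gB] mh hg; have h0 t : 0 <= h t by have /andP[] := hg t.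
split => //; apply: le_trans gB; apply: ge0_le_integral => //.
- by move=> t _; rewrite lee_fin.
- exact/measurable_EFinP.
- exact/measurable_EFinP.
- by move=> t _; rewrite lee_fin; have /andP[] := hg t.
Qed.

Lemma integral_boundW (h : T -> R) B B' : integral_bound h B -> B <= B' ->
  integral_bound h B'.
Proof.
by move=> [mh h0 hB] BB'; split => //; rewrite (le_trans hB)// lee_fin.
Qed.

Lemma integral_boundD (h g : T -> R) B B' :
  integral_bound h B -> integral_bound g B' ->
  integral_bound (fun t => h t + g t) (B + B').
Proof.
move=> [mh h0 hB] [mg g0 gB]; split.
- exact: measurable_funD.
- by move=> t; rewrite addr_ge0.
- under eq_integral do rewrite EFinD.
  rewrite ge0_integralD//; try exact/measurable_EFinP;
    try by move=> t _; rewrite lee_fin.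
  by rewrite EFinD leeD.
Qed.

Lemma integral_boundZ (h : T -> R) B k : 0 <= k -> integral_bound h B ->
  integral_bound (fun t => k * h t) (k * B).
Proof.
move=> k0 [mh h0 hB]; split.
- exact: measurable_funM.
- by move=> t; rewrite mulr_ge0.
- under eq_integral do rewrite EFinM.
  rewrite ge0_integralZl//; try exact/measurable_EFinP;
    try by move=> t _; rewrite lee_fin.
  by rewrite EFinM lee_wpmul2l.
Qed.

Lemma integral_bound_sum (I : Type) (s : seq I) (h : I -> T -> R) (B : I -> R) :
  (forall i, integral_bound (h i) (B i)) ->
  integral_bound (fun t => \sum_(i <- s) h i t) (\sum_(i <- s) B i).
Proof.
move=> hB; elim: s => [|i s IH].
  under eq_fun do rewrite big_nil.
  rewrite big_nil; split => //.
  by rewrite integral0.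
under eq_fun do rewrite big_cons.
by rewrite big_cons; exact: integral_boundD.
Qed.

Lemma integral_bound_ge0 (h : T -> R) (B : R) : integral_bound h B -> 0 <= B.
Proof.
move=> [_ h0 hB]; rewrite -lee_fin; apply: le_trans hB.
by apply: integral_ge0 => t _; rewrite lee_fin.
Qed.

End integral_bound.

(** * Power integrals on the line *)

Section line.
Context (R : realType).
Notation leb := (@lebesgue_measure R).

Lemma measurable_dist (q : R) : measurable_fun setT (fun t : R => `|t - q|).
Proof.
apply: measurableT_comp => //; exact: measurable_funB.
Qed.

Lemma measurable_dist_powR (q a : R) :
  measurable_fun setT (fun t : R => `|t - q| `^ a).
Proof.
by apply: (measurableT_comp (measurable_powR a)); exact: measurable_dist.
Qed.

Lemma measurable_max_powR (q a : R) :
  measurable_fun setT (fun t : R => (Num.max 1 `|t - q|) `^ a).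
Proof.
apply: (measurableT_comp (measurable_powR a)).
by apply: measurable_maxr => //; exact: measurable_dist.
Qed.

Lemma powR2_lt1 (b : R) : b < 0 -> 0 <= (2 `^ b : R) < 1.
Proof.
move=> b0; rewrite powR_ge0/=.
rewrite /powR (negbTE (lt0r_neq0 _)) ?ltr0n//.
by rewrite -[ltRHS]expR0 ltr_expR nmulr_rlt0// ln_gt0// ltr1n.
Qed.


Definition near_power (theta r q t : R) : R :=
  if `|t - q| <= r then `|t - q| `^ (- theta) else 0.

Lemma measurable_near_power theta r q :
  measurable_fun setT (near_power theta r q).
Proof.
apply: measurable_fun_ifT => //; last exact: measurable_dist_powR.
by apply: measurable_fun_ler => //; exact: measurable_dist.
Qed.

Lemma near_power_ge0 theta r q t : 0 <= near_power theta r q t.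
Proof. by rewrite /near_power; case: ifP => // _; rewrite powR_ge0. Qed.

(** The value at [t = q] is [0 `^ (- theta) = 0] here, which is why the centre
    falls in the first alternative of [dyadic_integral_le]. *)
Lemma near_power_bound (theta : R) : 0 < theta < 1 -> exists C : R, 0 <= C /\
  forall r q : R, 0 < r ->
    integral_bound leb (near_power theta r q) (C * r `^ (1 - theta)).
Proof.
move=> /andP[th0 th1].
pose z : R := 2 `^ (theta - 1).
have z01 : 0 <= z < 1 by apply: powR2_lt1; lra.
pose C0 : R := 2 * 2 `^ theta.
have C00 : 0 <= C0 by rewrite mulr_ge0// powR_ge0.
exists (C0 / (1 - z)); split.
  by rewrite divr_ge0// subr_ge0 ltW//; case/andP: z01.
move=> r q r0; split; [exact: measurable_near_power|exact: near_power_ge0|].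
rewrite mulrAC.
(* On the shell [r 2^-(k+1) < |t - q| <= r 2^-k], the power is at most its value
   at the inner radius. *)
apply: (@dyadic_integral_le _ _ q z _ (fun k => r / 2 ^+ k)
  (fun k => (r / 2 ^+ k.+1) `^ (- theta))) => //.
- exact: measurable_near_power.
- exact: near_power_ge0.
- by move=> k; rewrite divr_ge0 ?exprn_ge0// ltW.
- by move=> k; rewrite powR_ge0.
- move=> k.
  have E k' : (2 : R) ^+ k' = 2 `^ k'%:R by rewrite powR_mulrn.
  rewrite /C0 /z -powR_mulrn ?powR_ge0// -powRrM !E -!powRN.
  rewrite powRM ?powR_ge0//; last exact: ltW.
  rewrite -powRrM (_ : 2 * (r * _) * _ =
      2 * (r * r `^ (- theta)) * (2 `^ (- k%:R) * 2 `^ (- k.+1%:R * - theta)));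
    last by ring.
  rewrite -powRD; last by apply/implyP => _; rewrite pnatr_eq0.
  rewrite (_ : r * r `^ (- theta) = r `^ (1 - theta)); last first.
    by rewrite powRD ?powRr1 ?ltW//; apply/implyP => _; rewrite gt_eqF.
  rewrite (_ : 2 * 2 `^ theta * _ * _ =
      2 * r `^ (1 - theta) * (2 `^ theta * 2 `^ ((theta - 1) * k%:R)));
    last by ring.
  rewrite -powRD; last by apply/implyP => _; rewrite pnatr_eq0.
  rewrite le_eqVlt; apply/orP; left; apply/eqP; congr (_ * powR _ _).
  by rewrite -natr1; ring.
- move=> t; rewrite /near_power; case: ifPn => tr; last by left.
  have [->|tq] := eqVneq `|t - q| 0.
    by left; rewrite powR0// oppr_eq0 gt_eqF.
  right; have u0 : 0 < `|t - q| by rewrite lt_neqAle eq_sym tq /=.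
  have /dyadic_scale[k /andP[k1 k2]] : 1 <= r / `|t - q|.
    by rewrite ler_pdivlMr// mul1r.
  exists k; have k0 : 0 < (2 : R) ^+ k by rewrite exprn_gt0.
  split.
    by rewrite ler_pdivlMr// mulrC -ler_pdivlMr.
  apply: powRN_le; [exact: ltW|by rewrite divr_gt0// exprn_gt0|].
  by rewrite ler_pdivrMr ?exprn_gt0// mulrC -ler_pdivrMr// ltW.
Qed.

Lemma tail_power_bound (sigma : R) : 1 < sigma -> exists C : R, forall q : R,
  integral_bound leb (fun t : R => (Num.max 1 `|t - q|) `^ (- sigma)) C.
Proof.
move=> s1.
pose z : R := 2 `^ (1 - sigma).
have z01 : 0 <= z < 1 by apply: powR2_lt1; lra.
exists (4 / (1 - z)) => q.
split; [exact: measurable_max_powR|by move=> t; exact: powR_ge0|].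
apply: (@dyadic_integral_le _ _ q z _ (fun k => 2 ^+ k.+1)
  (fun k => (2 ^+ k) `^ (- sigma))) => //.
- exact: measurable_max_powR.
- move=> k; rewrite /z -!powR_mulrn ?powR_ge0// -!powRrM.
  rewrite -[k.+1%:R]natr1 powRD; last by apply/implyP => _; rewrite pnatr_eq0.
  rewrite powRr1// (_ : 2 * _ * _ = 4 * (2 `^ k%:R * 2 `^ (k%:R * - sigma)));
    last by ring.
  rewrite -powRD; last by apply/implyP => _; rewrite pnatr_eq0.
  rewrite le_eqVlt; apply/orP; left; apply/eqP; congr (_ * powR _ _).
  by ring.
- move=> t; right.
  have /dyadic_scale[k /andP[k1 k2]] : 1 <= Num.max 1 `|t - q|.
    by rewrite le_max lexx.
  exists k; split.
    by rewrite (le_trans _ (ltW k2))// le_max lexx orbT.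
  by apply: powRN_le => //; lra.
Qed.

(** The centres [p] of the interval and [q] of the singularity are independent:
    where [|t - q| > r] the power is at most [r `^ (- theta)], which integrates
    to a multiple of the same [r `^ (1 - theta)]. *)
Lemma local_power_bound (theta : R) : 0 < theta < 1 -> exists C : R, 0 <= C /\
  forall r p q : R, 0 < r ->
    integral_bound leb (fun t : R => (`|t - p| < r)%R%:R * `|t - q| `^ (- theta))
      (C * r `^ (1 - theta)).
Proof.
move=> th; have /andP[th0 th1] := th.
have [C [C0 HC]] := near_power_bound th.
exists (C + 2); split; first by rewrite addr_ge0.
move=> r p q r0.
have mI : measurable_fun setT (fun t : R => (`|t - p| < r)%R%:R : R).
  rewrite (_ : (fun t : R => _) = (fun t : R => if `|t - p| < r then 1 else 0)).
    apply: measurable_fun_ifT => //.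
    by apply: measurable_fun_ltr => //; exact: measurable_dist.
  by apply/funext => t; case: ifP.
have bI : integral_bound leb (fun t : R => (`|t - p| < r)%R%:R) (2 * r).
  split => //.
  rewrite (_ : (2 * r)%:E = (2 * r / (1 - 0))%:E); last by rewrite subr0 divr1.
  apply: (@dyadic_integral_le _ _ p 0 _ (fun=> r) (fun k => (k == 0)%:R)) => //.
  - by rewrite lexx ltr01.
  - by move=> k; exact: ltW.
  - by move=> k; rewrite expr0n.
  - move=> t; case: ltP => tr; last by left.
    by right; exists 0%N; rewrite (ltW tr).
have := integral_boundD (HC r q r0) (integral_boundZ (powR_ge0 r (- theta)) bI).
rewrite (_ : r `^ (- theta) * (2 * r) = 2 * r `^ (1 - theta)); last first.
  rewrite powRD ?powRr1 ?ltW//; first by ring.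
  by apply/implyP => _; rewrite gt_eqF.
rewrite -mulrDl => /integral_bound_le; apply.
  by apply: measurable_funM => //; exact: measurable_dist_powR.
move=> t; rewrite mulr_ge0 ?powR_ge0//=.
rewrite /near_power; case: (ltP `|t - p| r) => tp; rewrite ?mul0r ?mul1r ?mulr0.
  case: ifPn => tq; first by rewrite lerDl mulr_ge0// powR_ge0.
  rewrite add0r mulr1; apply: powRN_le => //; first exact: ltW.
  by rewrite ltW// ltNge.
by rewrite addr0; case: ifP => // _; rewrite powR_ge0.
Qed.

(** Away from the singularity, a product of negative powers of two quantities
    [>= 1] is at most the power of the smaller one with the exponents added;
    the sum of the tails centred at [q] and at [0] is therefore a bound
    independent of [q]. *)
Lemma global_power_bound (theta kappa : R) :
  0 < theta < 1 -> 0 < kappa -> 1 < theta + kappa -> exists C : R, forall q : R,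
    integral_bound leb
      (fun t : R => `|t - q| `^ (- theta) * (Num.max 1 `|t|) `^ (- kappa)) C.
Proof.
move=> th ka0 tk1; have /andP[th0 th1] := th.
have [C [C0 HC]] := near_power_bound th.
have [C' HC'] := tail_power_bound tk1.
exists (C * 1 `^ (1 - theta) + (C' + C')) => q.
have := integral_boundD (HC 1 q ltr01) (integral_boundD (HC' q) (HC' 0)).
move=> /integral_bound_le; apply.
  apply: measurable_funM; first exact: measurable_dist_powR.
  by have := measurable_max_powR 0 (- kappa); under eq_fun do rewrite subr0.
move=> t; rewrite mulr_ge0 ?powR_ge0//= subr0 /near_power.
set u := `|t - q|; set v := Num.max 1 `|t|.
have v1 : 1 <= v by rewrite le_max lexx.
have N a b : (0 : R) <= (a `^ b) by exact: powR_ge0.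
case: (leP u 1) => u1.
  have : v `^ (- kappa) <= 1 by apply: powRN_le1 => //; exact: ltW.
  move=> v2; have := N u (- theta); have := N 1 (- (theta + kappa)).
  have := N v (- (theta + kappa)); move: v2; nra.
rewrite add0r; have u0 : 0 < u by lra.
have v0 : 0 < v by lra.
have D x : 0 < x -> x `^ (- (theta + kappa)) = x `^ (- theta) * x `^ (- kappa).
  move=> x0; rewrite opprD powRD//; apply/implyP => _; exact: lt0r_neq0.
rewrite !D//; case: (leP u v) => uv.
  have : v `^ (- kappa) <= u `^ (- kappa) by apply: powRN_le => //; exact: ltW.
  have := N u (- theta); have := N v (- theta); have := N v (- kappa); nra.
have : u `^ (- theta) <= v `^ (- theta).
  by apply: powRN_le => //; exact: ltW.
have := N u (- theta); have := N u (- kappa); have := N v (- kappa); nra.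
Qed.

End line.

(** * Products of one-dimensional bounds *)

Section tensor.
Context (R : realType).
Notation leb := (@lebesgue_measure R).

Lemma integral_lebesgue_cons n (m : {sigma_finite_measure set (n.-tuple R) -> \bar R})
    (h : n.+1.-tuple R -> R) :
  measurable_fun setT h -> (forall t, 0 <= h t) ->
  (\int[lebesgue_cons m]_t (h t)%:E =
   \int[leb]_x \int[m]_y (h (tuple_cons (x, y)))%:E)%E.
Proof.
move=> mh h0.
have mhe : measurable_fun setT (EFin \o h) by exact/measurable_EFinP.
have he0 : {in setT, forall y, (0 <= (EFin \o h) y)%E}.
  by move=> y _; rewrite lee_fin.
have P := ge0_integral_pushforward (@measurable_tuple_cons R n) (leb \x m)%E
  measurableT mhe he0.
rewrite preimage_setT in P.
transitivity (\int[(leb \x m)%E]_z ((EFin \o h) \o tuple_cons) z)%E.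
  by rewrite -P; apply: eq_measure_integral => [|//]; exact: measurable_tuple_cons.
have mc := measurableT_comp mhe (@measurable_tuple_cons R n).
by rewrite fubini_tonelli1// => z; rewrite /= lee_fin.
Qed.

(** Tonelli's theorem for a function dominated by a product.  The domination is
    only asked off the hyperplanes [t_i = q_i]: a product of powers
    [|t_i - q_i|^-theta] vanishes there by the convention [0 `^ x = 0], and
    does not dominate the power of the norm. *)
Lemma integral_bound_tensor n (g : 'I_n -> R -> R) (B q : 'I_n -> R) (c : R)
    (h : n.-tuple R -> R) :
  0 <= c -> (forall i, integral_bound leb (g i) (B i)) ->
  measurable_fun setT h -> (forall t, 0 <= h t) ->
  (forall t, (forall i, tnth t i != q i) ->
     h t <= c * \prod_i g i (tnth t i)) ->
  integral_bound (borel_lebesgue_measure n) h (c * \prod_i B i).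
Proof.
move=> c0 gB mh h0 hle; split => //; move: hle.
elim: n g B q c h c0 gB mh h0 => [|n IH] g B q c h c0 gB mh h0.
  move=> /(_ [tuple]); rewrite !big_ord0 => hle /=.
  rewrite integral_dirac//; last exact/measurable_EFinP.
  rewrite diracT mul1e lee_fin; apply: hle; by case.
move=> hle /=.
rewrite integral_lebesgue_cons//.
set m := borel_lebesgue_measure n.
pose B' := \prod_i B (lift ord0 i).
have mcons : measurable_fun setT
    (fun z : measurableTypeR R * n.-tuple R => h (tuple_cons z)).
  exact: (measurableT_comp mh (@measurable_tuple_cons R n)).
have inner x : x != q ord0 ->
    (\int[m]_y (h (tuple_cons (x, y)))%:E <= (g ord0 x * (c * B'))%:E)%E.
  move=> xq; rewrite mulrA.
  apply: (IH (fun i => g (lift ord0 i)) _ (fun i => q (lift ord0 i))) => //.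
  - by rewrite mulr_ge0//; have [_ ->] := gB ord0.
  - exact: (measurableT_comp mcons (pair1_measurable x)).
  - move=> y yq.
    have tS i : tnth (tuple_cons (x, y)) (lift ord0 i) = tnth y i.
      by rewrite (tnth_nth 0)/= -tnth_nth.
    have t0 : tnth (tuple_cons (x, y)) ord0 = x by rewrite (tnth_nth 0).
    apply: (le_trans (hle _ _)).
      by move=> i; case: (unliftP ord0 i) => [j|] ->; rewrite ?tS ?t0.
    rewrite big_ord_recl t0 mulrCA mulrA le_eqVlt; apply/orP; left; apply/eqP.
    by congr (_ * _); apply: eq_bigr => i _; rewrite tS.
have [mg0 g00 g0B] := gB ord0.
apply: (@le_trans _ _ (\int[leb]_x (g ord0 x * (c * B'))%:E)%E).
  apply: ae_ge0_le_integral => //.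
  - by move=> x _; apply: integral_ge0 => y _; rewrite lee_fin.
  - apply: (@measurable_fun_fubini_tonelli_F _ _ _ _ _ m (EFin \o (h \o tuple_cons))) => //.
      exact/measurable_EFinP.
    by move=> z; rewrite /= lee_fin.
  - move=> x _; rewrite lee_fin mulr_ge0// mulr_ge0// prodr_ge0// => i _.
    exact: integral_bound_ge0 (gB _).
  - apply/measurable_EFinP; exact: measurable_funM.
  - exists [set q ord0]; split => //; first exact: lebesgue_measure_set1.
    move=> x /=; apply: contra_notP => /eqP xq _; exact: inner.
have B'0 : 0 <= c * B'.
  by rewrite mulr_ge0// prodr_ge0// => i _; exact: integral_bound_ge0 (gB _).
under eq_integral do rewrite mulrC.
have [_ _] := integral_boundZ B'0 (gB ord0).
by rewrite big_ord_recl -/B' [B ord0 * _]mulrC mulrA.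
Qed.

End tensor.

(** * Power kernels in Euclidean space *)

Section euclidean.
Context (R : realType) (n : nat).
Implicit Types x y z p : n.-tuple R.

Definition edist x y : R := enorm (tuple_sub x y).

Lemma edist_ge0 x y : 0 <= edist x y.
Proof. exact: sqrtr_ge0. Qed.

Lemma sumsq_ge0 x : 0 <= \sum_(i < n) tnth x i ^+ 2.
Proof. by apply: sumr_ge0 => i _; rewrite sqr_ge0. Qed.

Lemma edist_sqr x y : edist x y ^+ 2 = \sum_(i < n) (tnth x i - tnth y i) ^+ 2.
Proof.
rewrite /edist /enorm sqr_sqrtr ?sumsq_ge0//.
by apply: eq_bigr => i _; rewrite tnth_mktuple.
Qed.

Lemma edistC x y : edist x y = edist y x.
Proof.
apply/eqP; rewrite -(@eqrXn2 _ 2) ?edist_ge0// !edist_sqr; apply/eqP.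
by apply: eq_bigr => i _; ring.
Qed.

Lemma coord_le_enorm x i : `|tnth x i| <= enorm x.
Proof.
rewrite /enorm -sqrtr_sqr ler_sqrt ?sumsq_ge0// (bigD1 i)//= lerDl.
by apply: sumr_ge0 => j _; rewrite sqr_ge0.
Qed.

Lemma coord_le_edist x y i : `|tnth x i - tnth y i| <= edist x y.
Proof.
by have := coord_le_enorm (tuple_sub x y) i; rewrite tnth_mktuple.
Qed.

Lemma edist_gt0 x y : x <> y -> 0 < edist x y.
Proof.
move=> xy; rewrite lt_neqAle edist_ge0 andbT eq_sym; apply/eqP => d0.
apply: xy; apply/eq_from_tnth => i.
by have := coord_le_edist x y i; rewrite d0 normr_le0 subr_eq0 => /eqP.
Qed.

(** This weak triangle inequality follows from
    [(b + c)^2 <= 2 b^2 + 2 c^2] in each coordinate. *)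
Lemma edist_le_max x y z :
  edist x z <= 2 * Num.max (edist x y) (edist y z).
Proof.
set u := edist x y; set v := edist y z.
have u0 : 0 <= u := edist_ge0 x y.
have v0 : 0 <= v := edist_ge0 y z.
have m0 : 0 <= Num.max u v by rewrite le_max u0.
rewrite -(@ler_pXn2r _ 2) ?nnegrE ?mulr_ge0 ?edist_ge0//.
have : edist x z ^+ 2 <= 2 * u ^+ 2 + 2 * v ^+ 2.
  rewrite !edist_sqr !mulr_sumr -big_split/=; apply: ler_sum => i _.
  set a := tnth x i; set b := tnth y i; set c := tnth z i.
  by have := sqr_ge0 (a - b - (b - c)); nra.
move=> h; apply: (le_trans h); case: (leP u v) => uv; nra.
Qed.

Lemma measurable_enorm : measurable_fun setT (@enorm R n).
Proof.
rewrite (_ : @enorm R n =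
    (fun x => (\sum_(i < n) tnth x i ^+ 2) `^ 2^-1)); last first.
  by apply/funext => x; rewrite powR12_sqrt// sumsq_ge0.
apply: (measurableT_comp (measurable_powR _)).
apply: measurable_sum => i; apply: measurable_funX; exact: measurable_tnth.
Qed.

Lemma measurable_edist x : measurable_fun setT (edist x).
Proof.
rewrite (_ : edist x =
    (fun y => (\sum_(i < n) (tnth x i - tnth y i) ^+ 2) `^ 2^-1)); last first.
  apply/funext => y; rewrite -edist_sqr powR12_sqrt ?sqr_ge0//.
  by rewrite sqrtr_sqr ger0_norm ?edist_ge0.
apply: (measurableT_comp (measurable_powR _)).
apply: measurable_sum => i; apply: measurable_funX.
by apply: measurable_funB => //; exact: measurable_tnth.
Qed.

Lemma measurable_edist_powR x a : measurable_fun setT (fun y => edist x y `^ a).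
Proof.
apply: (measurableT_comp (measurable_powR a)); exact: measurable_edist.
Qed.

Lemma japanese_bracket_ge1 x : 1 <= japanese_bracket x.
Proof.
rewrite /japanese_bracket -{1}(sqrtr1 R) ler_sqrt; last first.
  by rewrite addr_ge0// sqr_ge0.
by rewrite lerDl sqr_ge0.
Qed.

Lemma coord_le_japanese_bracket x i :
  Num.max 1 `|tnth x i| <= japanese_bracket x.
Proof.
rewrite ge_max japanese_bracket_ge1/=; apply: (le_trans (coord_le_enorm x i)).
rewrite /japanese_bracket -[leLHS]ger0_norm; last exact: sqrtr_ge0.
rewrite -sqrtr_sqr ler_sqrt; last by rewrite addr_ge0// sqr_ge0.
by rewrite lerDr.
Qed.

Lemma measurable_japanese_bracket_powR a :
  measurable_fun setT (fun y : n.-tuple R => japanese_bracket y `^ a).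
Proof.
apply: (measurableT_comp (measurable_powR a)).
rewrite (_ : @japanese_bracket R n = (fun x => (1 + enorm x ^+ 2) `^ 2^-1)).
  apply: (measurableT_comp (measurable_powR _)).
  apply: measurable_funD => //; apply: measurable_funX.
  exact: measurable_enorm.
by apply/funext => x; rewrite powR12_sqrt// addr_ge0// sqr_ge0.
Qed.

(** The exponent is shared equally among the coordinates, which is what makes
    every factor integrable as soon as [a < n]. *)
Lemma powRN_le_prod (a u : R) (v : 'I_n -> R) : (0 < n)%N -> 0 <= a ->
  (forall i, 0 < v i <= u) ->
  u `^ (- a) <= \prod_i v i `^ (- (a / n%:R)).
Proof.
move=> n0 a0 vu.
have -> : u `^ (- a) = \prod_(i < n) u `^ (- (a / n%:R)).
  rewrite prodr_const card_ord -powR_mulrn ?powR_ge0// -powRrM; congr powR.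
  by rewrite mulNr divfK// pnatr_eq0 -lt0n.
apply: ler_prod => i _; rewrite powR_ge0/=; have /andP[v0 vle] := vu i.
by apply: powRN_le => //; rewrite divr_ge0.
Qed.

Lemma measurable_ball_ind p (r : R) :
  measurable_fun setT (fun y => (edist p y < r)%R%:R : R).
Proof.
rewrite (_ : (fun y => _) = (fun y => if edist p y < r then 1 else 0)).
  apply: measurable_fun_ifT => //.
  by apply: measurable_fun_ltr => //; exact: measurable_edist.
by apply/funext => y; case: ifP.
Qed.

Lemma ball_power_bound (M : R) : 0 < M < n%:R -> exists C : R, 0 <= C /\
  forall (r : R) p q, 0 < r ->
    integral_bound (borel_lebesgue_measure n)
      (fun y => (edist p y < r)%R%:R * edist q y `^ (- M))
      ((C * r `^ (1 - M / n%:R)) ^+ n).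
Proof.
move=> /andP[M0 Mn].
have n0 : 0 < n%:R :> R by apply: lt_trans Mn.
have n0' : (0 < n)%N by rewrite -(ltr0n R).
have th : 0 < M / n%:R < 1 by rewrite divr_gt0//= ltr_pdivrMr// mul1r.
have [C [C0 HC]] := local_power_bound th.
exists C; split => // r p q r0.
have -> : (C * r `^ (1 - M / n%:R)) ^+ n =
    1 * \prod_(i < n) (C * r `^ (1 - M / n%:R)).
  by rewrite mul1r prodr_const card_ord.
apply: (@integral_bound_tensor R n (fun i t =>
   (`|t - tnth p i| < r)%R%:R * `|t - tnth q i| `^ (- (M / n%:R))) _ (tnth q)).
- exact: ler01.
- by move=> i; exact: HC.
- apply: measurable_funM; first exact: measurable_ball_ind.
  exact: measurable_edist_powR.
- by move=> y; rewrite mulr_ge0 ?powR_ge0.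
move=> y yq; rewrite mul1r big_split/=; case: ltP => pr; last first.
  rewrite mul0r mulr_ge0// ?prodr_ge0// => i _; exact: powR_ge0.
rewrite [X in _ <= X * _]big1 => [|i _]; last first.
  suff -> : `|tnth y i - tnth p i| < r by [].
  by rewrite distrC; exact: le_lt_trans (coord_le_edist _ _ _) pr.
rewrite !mul1r; apply: powRN_le_prod => // [|i]; first exact: ltW.
by rewrite normr_gt0 subr_eq0 yq/= distrC coord_le_edist.
Qed.

Lemma ball_power_small (M e : R) : 0 < M < n%:R -> 0 < e ->
  exists r0 : R, 0 < r0 /\ forall (r : R) p q, 0 < r <= r0 ->
    integral_bound (borel_lebesgue_measure n)
      (fun y => (edist p y < r)%R%:R * edist q y `^ (- M)) e.
Proof.
move=> hM e0; have /andP[M0 Mn] := hM.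
have n0 : 0 < n%:R :> R by apply: lt_trans Mn.
have n0' : (0 < n)%N by rewrite -(ltr0n R).
have [C [C0 HC]] := ball_power_bound hM.
set b := 1 - M / n%:R.
have b0 : 0 < b by rewrite subr_gt0 ltr_pdivrMr// mul1r.
pose e1 := Num.min 1 e.
have e10 : 0 < e1 by rewrite lt_min ltr01.
have q0 : 0 < e1 / (C + 1) by rewrite divr_gt0// ltr_wpDl.
exists ((e1 / (C + 1)) `^ b^-1); split; first by rewrite powR_gt0.
move=> r p q /andP[r_gt0 rle]; apply: integral_boundW (HC r p q r_gt0) _.
have rb : r `^ b <= e1 / (C + 1).
  have : r `^ b <= ((e1 / (C + 1)) `^ b^-1) `^ b.
    by apply: ge0_ler_powR; rewrite ?nnegrE ?powR_ge0// ltW.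
  by rewrite -powRrM mulVf ?gt_eqF// powRr1// ltW.
have Cr : C * r `^ b <= e1.
  apply: (@le_trans _ _ (C * (e1 / (C + 1)))); first exact: ler_wpM2l.
  rewrite mulrA ler_pdivrMr ?ltr_wpDl//; nra.
have e11 : e1 <= 1 by rewrite ge_min lexx.
have e1e : e1 <= e by rewrite ge_min lexx orbT.
apply: le_trans e1e; apply: (@le_trans _ _ (e1 ^+ n)).
  by rewrite ler_pXn2r// nnegrE ?mulr_ge0 ?powR_ge0// ltW.
by case: (n) n0' => // k _; rewrite exprS ger_pMr// exprn_ile1// ltW.
Qed.

(** After the reduction to coordinates the exponents are [a / n < 1] and
    [b / n], of sum greater than [1]. *)
Lemma riesz_bracket_bound (a b : R) : 0 < a < n%:R -> 0 < b -> n%:R < a + b ->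
  exists J : R, forall x, integral_bound (borel_lebesgue_measure n)
    (fun y => edist x y `^ (- a) * japanese_bracket y `^ (- b)) J.
Proof.
move=> /andP[a0 an] b0 nab.
have n0 : 0 < n%:R :> R by apply: lt_trans an.
have n0' : (0 < n)%N by rewrite -(ltr0n R).
have th : 0 < a / n%:R < 1 by rewrite divr_gt0//= ltr_pdivrMr// mul1r.
have ka : 0 < b / n%:R by rewrite divr_gt0.
have tk : 1 < a / n%:R + b / n%:R by rewrite -mulrDl ltr_pdivlMr// mul1r.
have [C HC] := global_power_bound th ka tk.
exists (1 * \prod_(i < n) C) => x.
apply: (@integral_bound_tensor R n (fun i t =>
   `|t - tnth x i| `^ (- (a / n%:R)) * (Num.max 1 `|t|) `^ (- (b / n%:R)))
   _ (tnth x)).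
- exact: ler01.
- by move=> i; exact: HC.
- apply: measurable_funM; first exact: measurable_edist_powR.
  exact: measurable_japanese_bracket_powR.
- by move=> y; rewrite mulr_ge0 ?powR_ge0.
move=> y yx; rewrite mul1r big_split/=; apply: ler_pM; rewrite ?powR_ge0//.
  apply: powRN_le_prod => // [|i]; first exact: ltW.
  by rewrite normr_gt0 subr_eq0 yx/= distrC coord_le_edist.
apply: powRN_le_prod => // [|i]; first exact: ltW.
by rewrite coord_le_japanese_bracket lt_max ltr01.
Qed.

End euclidean.

(** The larger of [v] and [w] is at least [u / 2].  Of its negative power, the
    part with exponent [Num.min a b] is estimated by [u / 2], and what remains
    is absorbed into the power of the smaller one. *)
Lemma three_point_power (R : realType) (a b u v w : R) :
  0 < a -> 0 < b -> 0 < u -> 0 <= v -> 0 <= w -> u <= 2 * Num.max v w ->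
  v `^ (- a) * w `^ (- b) <= (u / 2) `^ (- Num.min a b) *
    (v `^ (- Num.max a b) + w `^ (- Num.max a b)).
Proof.
wlog vw : a b v w / w <= v.
  move=> H a0 b0 u0 v0 w0 uvw; case: (leP w v) => [vw|/ltW wv].
    exact: H.
  rewrite mulrC addrC minC maxC; apply: H => //; by rewrite maxC.
move=> a0 b0 u0 v0 w0; rewrite (max_idPl vw) => uv.
have N (c d : R) : 0 <= c `^ d by exact: powR_ge0.
have uv' : u / 2 <= v by rewrite ler_pdivrMr// mulrC.
have u20 : 0 < u / 2 by rewrite divr_gt0.
have [->|w0'] := eqVneq w 0.
  by rewrite [X in _ * X <= _]powR0 ?oppr_eq0 ?gt_eqF// mulr0 mulr_ge0// addr_ge0.
have {w0} w0 : 0 < w by rewrite lt_neqAle eq_sym w0'.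
rewrite mulrDr; apply: (@le_trans _ _
   ((u / 2) `^ (- Num.min a b) * w `^ (- Num.max a b))); last first.
  by rewrite lerDr mulr_ge0.
case: (leP a b) => ab.
  by rewrite ler_wpM2r// powRN_le// ltW.
have -> : v `^ (- a) = v `^ (- b) * v `^ (- (a - b)).
  by rewrite -powRD; [congr powR; ring|apply/implyP => _; rewrite gt_eqF//; lra].
have -> : w `^ (- a) = w `^ (- (a - b)) * w `^ (- b).
  by rewrite -powRD; [congr powR; ring|apply/implyP => _; rewrite gt_eqF].
rewrite mulrA ler_wpM2r//; apply: ler_pM => //.
  by apply: powRN_le => //; exact: ltW.
by apply: powRN_le => //; rewrite subr_ge0 ltW.
Qed.

(** * Completed Lebesgue measure *)

Section completion.
Context (R : realType) (n : nat).
Notation nu := (@borel_lebesgue_measure R n).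
Notation mu := (@lebesgue_measureRn R n).

Lemma measurable_lebesgueRn (A : set (n.-tuple R)) :
  measurable A -> measurable (A : set (lebesgueRn R n)).
Proof. exact: caratheodory_measurable_mu_ext. Qed.

Lemma measurable_fun_lebesgueRn (h : n.-tuple R -> R) :
  measurable_fun setT h -> measurable_fun [set: lebesgueRn R n] h.
Proof.
by move=> mh _ Y mY; apply: measurable_lebesgueRn; exact: mh.
Qed.

Lemma lebesgue_measureRnE (A : set (n.-tuple R)) :
  measurable A -> mu A = nu A.
Proof. by move=> mA; exact: measurable_mu_extE. Qed.

(** The identity from the completed space to the Borel space is measurable and
    pushes the completed measure forward to the Borel one. *)
Lemma integral_lebesgueRn (h : n.-tuple R -> R) :
  measurable_fun setT h -> (forall y, 0 <= h y) ->
  (\int[mu]_y (h y)%:E = \int[nu]_y (h y)%:E)%E.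
Proof.
move=> mh h0.
pose phi : lebesgueRn R n -> n.-tuple R := id.
have mphi : measurable_fun setT phi.
  move=> _ Y mY; rewrite setTI; exact: measurable_lebesgueRn.
have mhe : measurable_fun setT (EFin \o h) by exact/measurable_EFinP.
have he0 : {in setT, forall y, (0 <= (EFin \o h) y)%E}.
  by move=> y _; rewrite lee_fin.
have := ge0_integral_pushforward mphi mu measurableT mhe he0.
rewrite preimage_setT => <-.
by apply: eq_measure_integral => A mA _; exact: lebesgue_measureRnE.
Qed.

Lemma integral_le_bound (G : lebesgueRn R n -> R) (H : n.-tuple R -> R) (B : R) :
  measurable_fun setT G -> integral_bound nu H B ->
  {ae mu, forall y, `|G y| <= H y} ->
  (`|\int[mu]_y (G y)%:E| <= B%:E)%E.
Proof.
move=> mG [mH H0 HB] GH.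
have mGe : measurable_fun setT (EFin \o G) by exact/measurable_EFinP.
apply: (le_trans (le_abse_integral mu measurableT mGe)).
apply: le_trans HB; rewrite -integral_lebesgueRn//.
apply: ae_ge0_le_integral.
- exact: measurableT.
- by move=> y _; exact: abse_ge0.
- exact: (measurableT_comp (@abse_measurable R setT)).
- by move=> y _; rewrite lee_fin.
- by apply/measurable_EFinP; exact: measurable_fun_lebesgueRn.
- by apply: filterS GH => y Gy _; rewrite /= lee_fin.
Qed.

End completion.

Section points.
Context (R : realType) (n : nat).

Lemma measurable_point (p : n.-tuple R) : measurable [set p].
Proof.
rewrite (_ : [set p] = setT `&` edist p @^-1` [set 0]).
  by apply: (measurable_edist p) => //; exact: measurable_set1.
rewrite setTI; apply/seteqP; split => [y ->|y /= y0].
  apply/eqP; rewrite -sqrf_eq0 edist_sqr; apply/eqP.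
  by rewrite big1// => i _; rewrite subrr expr0n.
apply: contrapT => /nesym /edist_gt0; by rewrite y0 ltxx.
Qed.

Lemma borel_lebesgue_measure_point (p : n.-tuple R) : (0 < n)%N ->
  borel_lebesgue_measure n [set p] = 0%E.
Proof.
move=> n0; have mp := measurable_point p.
have bI : integral_bound (borel_lebesgue_measure n) (\1_[set p] : _ -> R)
    (0 * \prod_(i < n) 0).
  (* The indicator of [p] is dominated by [0] off the hyperplanes through [p],
     because there is at least one coordinate. *)
  apply: (@integral_bound_tensor R n (fun=> cst 0) _ (tnth p)) => //.
  - move=> i; split => //.
    by under eq_integral do rewrite /cst/=; rewrite integral0.
  - move=> t; rewrite indicE; case: n n0 p mp t => // k _ p mp t tp.
    rewrite memNset ?mul0r// => /= E.
    by have := tp ord0; rewrite E eqxx.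
have [_ _] := bI; rewrite mul0r integral_indic// setIT => h.
by apply/eqP; rewrite eq_le h measure_ge0.
Qed.

Lemma ae_off_points (N : nat) (p : 'I_N -> n.-tuple R) : (0 < n)%N ->
  {ae @lebesgue_measureRn R n, forall y, ~ range p y}.
Proof.
move=> n0; have : \forall y \ae @lebesgue_measureRn R n, forall i : 'I_N, y <> p i.
  apply: (@filter_forall _ _ (fun i y => y <> p i) _
    (ae_filter_ringOfSetsType (@lebesgue_measureRn R n))) => i.
  exists [set p i]; split.
  - exact: measurable_lebesgueRn (measurable_point _).
  - rewrite [LHS](lebesgue_measureRnE (measurable_point _)).
    exact: borel_lebesgue_measure_point.
  - by move=> y /= /contrapT.
apply: (@filterS _ _ (ae_filter_ringOfSetsType (@lebesgue_measureRn R n))).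
by move=> y yp [i _ /esym]; exact: yp.
Qed.

End points.

(** * Self-improvement of the bound on the solution *)

Section weight.
Context (R : realType) (n N : nat) (alpha : R) (p : 'I_N -> n.-tuple R).

Definition weight (y : n.-tuple R) : R :=
  1 + \sum_(i < N) edist y (p i) `^ (- alpha).

Lemma weight_ge1 y : 1 <= weight y.
Proof. by rewrite lerDl sumr_ge0// => i _; rewrite powR_ge0. Qed.

Lemma weight_ge_power y i : 1 + edist y (p i) `^ (- alpha) <= weight y.
Proof.
rewrite lerD2l (bigD1 i)//= lerDl sumr_ge0// => j _; exact: powR_ge0.
Qed.

(** The two bounds say that, on functions supported in the small balls, the
    operator with kernel [|x - y|^-a] maps, off the points, [1] below [e] and
    [weight] below [e * weight].  The term of index [j] of [weight] is treated by
    [three_point_power], with [x], [y] and [p j]. *)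
Lemma riesz_weight_small (a e : R) :
  0 < a < n%:R -> 0 < alpha < n%:R -> 0 < e ->
  exists r : R, 0 < r /\ forall x, ~ range p x -> forall i,
    integral_bound (borel_lebesgue_measure n)
      (fun y => (edist (p i) y < r)%R%:R * edist x y `^ (- a)) e /\
    integral_bound (borel_lebesgue_measure n)
      (fun y => (edist (p i) y < r)%R%:R * edist x y `^ (- a) * weight y)
      (e * weight x).
Proof.
move=> ha halpha e0; have /andP[a0 an] := ha; have /andP[al0 aln] := halpha.
pose M := Num.max a alpha.
have hM : 0 < M < n%:R by rewrite lt_max a0 gt_max an aln.
(* [e / L] on each of the integrals below leaves [e * weight x] in total. *)
pose L : R := 1 + N%:R * (2 `^ alpha * 2).
have L1 : 1 <= L by rewrite lerDl mulr_ge0// mulr_ge0// powR_ge0.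
have L0 : 0 < L by lra.
have e1 : 0 < e / L by rewrite divr_gt0.
have [ra [ra0 Ha]] := ball_power_small ha e1.
have [rM [rM0 HM]] := ball_power_small hM e1.
pose r := Num.min ra rM.
have r0 : 0 < r by rewrite lt_min ra0.
have rra : 0 < r <= ra by rewrite r0 ge_min lexx.
have rrM : 0 < r <= rM by rewrite r0 ge_min lexx orbT.
exists r; split => // x xp i.
have eL : e / L <= e by rewrite ler_pdivrMr// ler_peMr// ltW.
split; first exact: integral_boundW (Ha r (p i) x rra) eL.
have bj (j : 'I_N) := integral_boundZ
  (mulr_ge0 (powR_ge0 2 alpha) (le_trans ler01 (weight_ge1 x)))
  (integral_boundD (HM r (p i) x rrM) (HM r (p i) (p j) rrM)).
have := integral_boundD (Ha r (p i) x rra)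
  (integral_bound_sum (index_enum 'I_N) bj).
rewrite sumr_const card_ord => H.
apply: (@integral_boundW _ _ _ _ _
    (e / L + (2 `^ alpha * weight x * (e / L + e / L)) *+ N)); last first.
  have w1 := weight_ge1 x.
  rewrite -mulr_natl [leLHS](_ : _ =
    e / L * (1 + N%:R * (2 `^ alpha * 2) * weight x)); last by ring.
  apply: (@le_trans _ _ (e / L * (L * weight x))).
    rewrite ler_wpM2l ?(ltW e1)// /L.
    by rewrite mulrDl mul1r lerD2r.
  by rewrite mulrA divfK// gt_eqF.
apply: integral_bound_le H _ _.
  apply: measurable_funM.
    apply: measurable_funM; first exact: measurable_ball_ind.
    exact: measurable_edist_powR.
  apply: measurable_funD => //; apply: measurable_sum => j.
  under eq_fun do rewrite edistC; exact: measurable_edist_powR.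
move=> y; rewrite mulr_ge0 ?mulr_ge0 ?powR_ge0 ?(le_trans ler01 (weight_ge1 _))//=.
rewrite {1}/weight mulrDr mulr1 lerD2l mulr_sumr; apply: ler_sum => j _.
case: (edist (p i) y < r); last by rewrite !mul0r addr0 mulr0.
rewrite !mul1r.
have u0 : 0 < edist x (p j).
  by apply: edist_gt0 => xpj; apply: xp; exists j.
apply: le_trans (three_point_power a0 al0 u0 (edist_ge0 x y) (edist_ge0 y (p j))
  (edist_le_max x y (p j))) _.
rewrite [edist y _]edistC; apply: ler_wpM2r.
  by rewrite addr_ge0 ?powR_ge0.
set u := edist x (p j) in u0 *.
have u20 : 0 < u / 2 by rewrite divr_gt0.
have two : 1 <= (2 : R) `^ alpha.
  apply: (@le_trans _ _ (1 `^ alpha)); first by rewrite powR1.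
  by apply: ge0_ler_powR; rewrite ?nnegrE//; lra.
apply: (@le_trans _ _ (2 `^ alpha * (1 + u `^ (- alpha)))); last first.
  by rewrite ler_wpM2l ?powR_ge0//; exact: weight_ge_power.
apply: (@le_trans _ _ (1 + (u / 2) `^ (- alpha))).
  case: (leP 1 (u / 2)) => u2.
    apply: (@le_trans _ _ 1); last by rewrite lerDl powR_ge0.
    by apply: powRN_le1 => //; rewrite le_min !ltW.
  apply: (@le_trans _ _ ((u / 2) `^ (- alpha))); last by rewrite lerDr.
  apply: ger_powR; first by rewrite u20 ltW.
  by rewrite lerN2 ge_min lexx orbT.
have -> : (u / 2) `^ (- alpha) = 2 `^ alpha * u `^ (- alpha).
  rewrite powRM ?invr_ge0//; last exact: ltW.
  by rewrite -(powR_inv1 (ler0n R 2)) -powRrM mulrNN mul1r mulrC.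
by rewrite mulrDr mulr1 lerD2r.
Qed.

End weight.

Lemma le_of_geometric_error (R : realType) (u v c : R) :
  (forall k, u <= v + c * 2^-1 ^+ k) -> u <= v.
Proof.
move=> h; rewrite leNgt; apply/negP => vu.
have d0 : 0 < u - v by rewrite subr_gt0.
have c0 : 0 < c by have := h 0%N; rewrite expr0; lra.
have := archi_boundP (ltW (divr_gt0 c0 d0)); set k := Num.bound _ => ck.
have k2 : (k%:R : R) < 2 ^+ k by rewrite -natrX ltr_nat ltn_expl.
have P : 0 < (2 : R) ^+ k by rewrite exprn_gt0.
have : c / (u - v) < 2 ^+ k by apply: lt_trans k2.
rewrite ltr_pdivrMr// => ck'.
have := h k; rewrite exprVn -lerBlDl ler_pdivlMr// leNgt mulrC; move/negP; apply.
by [].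
Qed.

Lemma bounded_off_points_Lfun (R : realType) (n N : nat)
    (p : 'I_N -> n.-tuple R) (f : n.-tuple R -> R) (K : R) :
  (0 < n)%N -> measurable_fun [set: lebesgueRn R n] f ->
  (forall y, ~ range p y -> `|f y| <= K) ->
  f \in Lfun (lebesgue_measureRn n) +oo%E.
Proof.
move=> n0 mf fK; rewrite inE; apply/andP; split; rewrite inE//.
rewrite /finite_norm /= unlock /=.
case: ifP => // _; apply: (@le_lt_trans _ _ K%:E); last exact: ltry.
apply/ess_supP.
apply: (@filterS _ _ (ae_filter_ringOfSetsType (@lebesgue_measureRn R n))
  _ _ _ (ae_off_points p n0)) => y yp.
by rewrite /= lee_fin; exact: fK.
Qed.

(** The constant [A] comes from the complement of the balls and depends on their
    radius, which is fixed before [P] and [D] are given.  The radius makes the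
    operator on the [N] balls, with all constants included, at most one half. *)
Lemma riesz_convolution_improve (R : realType) (n N : nat) (s alpha beta C : R)
    (p : 'I_N -> n.-tuple R) (f V : n.-tuple R -> R) :
  0 < s < n%:R / 2 -> 0 < alpha < n%:R -> 2 * s < beta -> 0 < C ->
  measurable_fun [set: lebesgueRn R n] f ->
  measurable_fun [set: lebesgueRn R n] V ->
  (forall x, ~ range p x ->
     (f x)%:E = convolution (riesz_potential s) (fun y => V y * f y) x) ->
  (forall y, ~ range p y -> `|f y| <= C * weight alpha p y) ->
  (forall y, ~ range p y -> `|V y| <= C * japanese_bracket y `^ (- beta)) ->
  exists A : R, forall P D, 0 <= P -> 0 <= D ->
    (forall y, ~ range p y -> `|f y| <= P + D * weight alpha p y) ->
    forall x, ~ range p x -> `|f x| <= A + P / 2 + D / 2 * weight alpha p x.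
Proof.
move=> /andP[s0 sn] halpha hbeta C0 mf mV fconv fw Vb.
pose a := n%:R - 2 * s.
have sn' : 2 * s < n%:R by rewrite mulrC -ltr_pdivlMr.
have ha : 0 < a < n%:R by rewrite /a; apply/andP; split; lra.
have /andP[al0 aln] := halpha.
have n0 : (0 < n)%N by rewrite -(ltr0n R); lra.
have [J HJ] : exists J, forall x, integral_bound (borel_lebesgue_measure n)
    (fun y => edist x y `^ (- a) * japanese_bracket y `^ (- beta)) J.
  by apply: riesz_bracket_bound => //; rewrite /a; lra.
have [c cE] : exists c, riesz_const n s = c by exists (riesz_const n s).
have [k kE k0] : exists2 k, k = `|c| * C & 0 <= k.
  by exists (`|c| * C) => //; rewrite mulr_ge0// ltW.
pose e := (2 * (k + 1) * (N%:R + 1))^-1.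
have N0 : 0 <= N%:R :> R by [].
have e0 : 0 < e by rewrite invr_gt0 !mulr_gt0//; lra.
have keN : k * e * N%:R <= 2^-1.
  rewrite /e mulrAC ler_pdivrMr; last by rewrite !mulr_gt0//; lra.
  by rewrite -mulrA mulKf//; nra.
have [r [r0 Hr]] := riesz_weight_small p ha halpha e0.
(* [C * (1 + N r^-alpha)] bounds [f] off the balls of radius [r]. *)
pose K := k * (C * (1 + N%:R * r `^ (- alpha))).
have K0 : 0 <= K.
  by rewrite !mulr_ge0 ?(ltW C0)// addr_ge0// mulr_ge0// powR_ge0.
exists (K * J) => P D P0 D0 fPD x xp.
pose w := weight alpha p.
have w0 y : 0 <= w y by apply: le_trans (weight_ge1 alpha p y).
pose chi i y : R := (edist (p i) y < r)%R%:R.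
have bi (i : 'I_N) : integral_bound (borel_lebesgue_measure n)
    (fun y => k * P * (chi i y * edist x y `^ (- a)) +
              k * D * (chi i y * edist x y `^ (- a) * w y))
    (k * P * e + k * D * (e * w x)).
  have [b1 b2] := Hr x xp i.
  apply: integral_boundD; first exact: integral_boundZ (mulr_ge0 k0 P0) b1.
  exact: integral_boundZ (mulr_ge0 k0 D0) b2.
have bH := integral_boundD (integral_boundZ K0 (HJ x))
  (integral_bound_sum (index_enum 'I_N) bi).
set H := (fun y => _ + _) in bH.
rewrite sumr_const card_ord in bH.
pose G (y : lebesgueRn R n) : R :=
  riesz_potential s (tuple_sub x y) * (V y * f y).
have GE y : G y = c * edist x y `^ (- a) * (V y * f y).
  by rewrite /G /riesz_potential cE powRN.
have mG : measurable_fun [set: lebesgueRn R n] G.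
  rewrite (_ : G = fun y => c * edist x y `^ (- a) * (V y * f y)).
    apply: measurable_funM; last exact: measurable_funM.
    apply: measurable_fun_lebesgueRn; apply: measurable_funM => //.
    exact: measurable_edist_powR.
  by apply/funext => y; exact: GE.
(* If a ball contains [y], the corresponding term of the sum in [H] dominates;
   otherwise the first term does. *)
have GH y : ~ range p y -> `|G y| <= H y.
  move=> yp; rewrite GE !normrM (ger0_norm (powR_ge0 _ _)).
  set u := edist x y `^ (- a); have u0 : 0 <= u by exact: powR_ge0.
  have Vy := Vb y yp.
  set b := japanese_bracket y `^ (- beta) in Vy.
  have b0 : 0 <= b by exact: powR_ge0.
  have b1 : b <= 1.
    by apply: powRN_le1 (japanese_bracket_ge1 y); lra.
  have chi0 i : 0 <= chi i y by [].
  have termge0 i : 0 <= k * P * (chi i y * u) + k * D * (chi i y * u * w y).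
    by rewrite addr_ge0// !mulr_ge0.
  have [/existsP[i iy]|] := boolP [exists i : 'I_N, edist (p i) y < r].
    apply: (@le_trans _ _ (k * P * (chi i y * u) + k * D * (chi i y * u * w y))).
      rewrite /chi iy mul1r.
      have Vy1 : `|V y| <= C by apply: le_trans Vy _; rewrite ger_pMr.
      have -> : k * P * u + k * D * (u * w y) = k * u * (P + D * w y) by ring.
      rewrite kE -!mulrA ler_wpM2l// [leRHS]mulrCA ler_wpM2l//.
      by apply: ler_pM => //; exact: fPD.
    rewrite /H (bigD1 i)//= addrCA lerDl addr_ge0//.
      by rewrite mulr_ge0// mulr_ge0.
    by apply: sumr_ge0 => j _; exact: termge0.
  rewrite negb_exists => /forallP far.
  apply: (@le_trans _ _ (K * (u * b))); last first.
    by rewrite /H lerDl; apply: sumr_ge0 => j _; exact: termge0.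
  have fy : `|f y| <= C * (1 + N%:R * r `^ (- alpha)).
    apply: le_trans (fw y yp) _; rewrite ler_wpM2l ?(ltW C0)// lerD2l.
    rewrite mulr_natl -[N in leRHS]card_ord -sumr_const; apply: ler_sum => i _.
    apply: powRN_le => //; first exact: ltW.
    by rewrite edistC leNgt.
  rewrite /K kE; set Q := C * (1 + _) in fy *.
  have -> : `|c| * C * Q * (u * b) =
    `|c| * u * (C * b * Q) by ring.
  by rewrite ler_wpM2l ?mulr_ge0//; apply: ler_pM.
have := integral_le_bound mG bH.
have -> : (\int[lebesgue_measureRn n]_y (G y)%:E = (f x)%:E)%E.
  by rewrite fconv.
rewrite /= lee_fin => hle; apply: le_trans (hle _) _.
  apply: (@filterS _ _ (ae_filter_ringOfSetsType (@lebesgue_measureRn R n))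
    _ _ _ (ae_off_points p n0)); exact: GH.
rewrite -addrA lerD2l.
rewrite [leLHS](_ : _ = k * e * N%:R * (P + D * w x)); last by ring.
have -> : P / 2 + D / 2 * weight alpha p x = 2^-1 * (P + D * w x).
  by rewrite /w; field.
by rewrite ler_wpM2r// addr_ge0// mulr_ge0.
Qed.

Unset Implicit Arguments.

Theorem lemmaA2 (R : realType) (n : nat) (s alpha beta : R)
  (hs : 0 < s < n%:R / 2) (halpha : 0 < alpha < n%:R) (hbeta : 2 * s < beta)
  (N : nat) (p : 'I_N -> n.-tuple R) (hp : injective p)
  (f V : n.-tuple R -> R)
  (mf : measurable_fun [set: lebesgueRn R n] f)
  (mV : measurable_fun [set: lebesgueRn R n] V)
  (hconv : forall x, ~ range p x ->
     (f x)%:E = convolution (riesz_potential s) (fun y => V y * f y) x)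
  (hbound : exists C : R, 0 < C /\ forall y, ~ range p y ->
     `|f y| <= C * (1 + \sum_(i < N) 1 / enorm (tuple_sub y (p i)) `^ alpha) /\
     `|V y| <= C / japanese_bracket y `^ beta) :
  f \in Lfun (lebesgue_measureRn n) +oo%E.
Proof.
have /andP[s0 sn] := hs; have /andP[al0 aln] := halpha.
have n0 : (0 < n)%N by rewrite -(ltr0n R); lra.
have [C [C0 hC]] := hbound.
have fw y : ~ range p y -> `|f y| <= C * weight alpha p y.
  move=> /hC[+ _]; rewrite /weight; under eq_bigr do rewrite div1r -powRN.
  by [].
have Vb y : ~ range p y -> `|V y| <= C * japanese_bracket y `^ (- beta).
  by move=> /hC[_]; rewrite powRN.
have [A HA] := riesz_convolution_improve hs halpha hbeta C0 mf mV hconv fw Vb.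
(* The iteration needs a nonnegative constant. *)
pose B := Num.max 0 A.
have B0 : 0 <= B by rewrite le_max lexx.
have AB : A <= B by rewrite le_max lexx orbT.
have step k y : ~ range p y ->
    `|f y| <= 2 * B + C * 2^-1 ^+ k * weight alpha p y.
  elim: k y => [|k IH] y yp.
    rewrite expr0 mulr1; apply: le_trans (fw y yp) _.
    by rewrite lerDr mulr_ge0.
  have D0 : 0 <= C * 2^-1 ^+ k by rewrite mulr_ge0 ?(ltW C0)// exprn_ge0// invr_ge0.
  have P0 : 0 <= 2 * B by rewrite mulr_ge0.
  apply: le_trans (HA _ _ P0 D0 IH y yp) _.
  rewrite exprSr mulrA lerD2r; lra.
apply: (bounded_off_points_Lfun (p := p) (K := 2 * B) n0 mf) => y yp.
apply: (@le_of_geometric_error _ _ _ (C * weight alpha p y)) => k.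
by rewrite mulrAC; exact: step.
Qed.
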